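(* Let $\varepsilon>0$ and let $P$ be a probability on $\mathbb{R}^d$ with a Lebesgue density $r_P$ such that $\log r_P\in L_1(P)$. Then $P*N_d(0,\tfrac{\varepsilon}{2}I_d)$ is the unique minimizer of $Q\mapsto\mathcal{W}^2_{2,\varepsilon}(P,Q)$ over the set of all probabilities $Q$ on $\mathbb{R}^d$.
   Context: For probabilities $P,Q$ on $\mathbb{R}^d$, $\Pi(P,Q)$ is the set of probabilities on $\mathbb{R}^d\times\mathbb{R}^d$ with marginals $P$ and $Q$. For a probability $\pi$ on $\mathbb{R}^d\times\mathbb{R}^d$, $H(\pi)=\int r(x,y)\log r(x,y)\,dx\,dy$ if $\pi$ has a Lebesgue density $r$, and $H(\pi)=+\infty$ otherwise. $\mathcal{W}^2_{2,\varepsilon}(P,Q)=\min_{\pi\in\Pi(P,Q)}\big[\int\|x-y\|^2\,d\pi(x,y)+\varepsilon H(\pi)\big]$. $*$ denotes convolution of measures and $N_d(0,\frac{\varepsilon}{2}I_d)$ the centered Gaussian on $\mathbb{R}^d$ with covariance $\frac{\varepsilon}{2}I_d$. *)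

(* Defs.v *)
From HB Require Import structures.
From mathcomp Require Import all_boot all_order all_algebra.
From mathcomp Require Import all_classical all_reals all_analysis.

Set Implicit Arguments.
Unset Strict Implicit.
Unset Printing Implicit Defensive.

Import Order.TTheory GRing.Theory Num.Theory.
Import numFieldNormedType.Exports.

Local Open Scope classical_set_scope.
Local Open Scope ring_scope.

(* The ambient space R^d is modelled as d.-tuple R, equipped with the
   product (= Borel) sigma-algebra generated by the coordinate maps. *)
Notation Rd R d := (d.-tuple R).

Section defs.
Context (R : realType) (d : nat).

Definition sqnorm (x : Rd R d) : R := \sum_(i < d) (tnth x i) ^+ 2.
Definition sqdist (x y : Rd R d) : R := \sum_(i < d) (tnth x i - tnth y i) ^+ 2.
Definition tadd (x y : Rd R d) : Rd R d := [tuple tnth x i + tnth y i | i < d].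

Definition box (a b : 'I_d -> R) : set (Rd R d) :=
  [set x | forall i, a i <= tnth x i <= b i].

(* mu is Lebesgue measure on R^d: it assigns to every box its volume
   (this characterizes Lebesgue measure on the Borel sets uniquely). *)
Definition is_lebesgue (mu : set (Rd R d) -> \bar R) : Prop :=
  forall a b : 'I_d -> R, (forall i, a i <= b i) ->
    mu (box a b) = (\prod_(i < d) (b i - a i))%:E.

(* density of N_d(0, eps/2 I_d) *)
Definition gauss_density (eps : R) (z : Rd R d) : R :=
  (pi * eps) `^ (- (d%:R / 2)) * expR (- (sqnorm z / eps)).

Variable mu : {sigma_finite_measure set (Rd R d) -> \bar R}.

Definition leb2 := (mu \x mu)%E.

Definition is_density2 (p : probability (Rd R d * Rd R d)%type R)
    (r : Rd R d * Rd R d -> R) : Prop :=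
  measurable_fun setT r /\ (forall z, 0 <= r z) /\
  forall A, measurable A -> p A = (\int[leb2]_(z in A) (r z)%:E)%E.

(* H(pi) = \int r log r if pi has a Lebesgue density r, +oo otherwise
   (all densities are a.e. equal, so the infimum is just that value;
   the infimum of the empty set is +oo). *)
Definition entropy2 (p : probability (Rd R d * Rd R d)%type R) : \bar R :=
  ereal_inf [set (\int[leb2]_z ((r z) * ln (r z))%:E)%E | r in is_density2 p].

Definition couplings (P Q : probability (Rd R d) R) :
    set (probability (Rd R d * Rd R d)%type R) :=
  [set p | (forall A, measurable A -> p (A `*` setT) = P A) /\
           (forall B, measurable B -> p (setT `*` B) = Q B)].

(* int ||x-y||^2 dpi + eps H(pi); the sum is read with the convention
   +oo + (-oo) = +oo (dual addition), i.e. it is +oo when the cost is +oo. *)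
Definition eot_objective (eps : R) (p : probability (Rd R d * Rd R d)%type R) : \bar R :=
  dual_adde (\int[p]_z (sqdist z.1 z.2)%:E)%E (eps%:E * entropy2 p)%E.

Definition W22eps (eps : R) (P Q : probability (Rd R d) R) : \bar R :=
  ereal_inf [set eot_objective eps p | p in couplings P Q].

Definition conv_gauss (eps : R) (P : probability (Rd R d) R) (A : set (Rd R d)) : \bar R :=
  (\int[P]_x \int[mu]_z (\1_A (tadd x z) * gauss_density eps z)%:E)%E.

End defs.

(* Main.v *)
(* Write g for the Gaussian density, m(x, y) = rP(x) g(y - x), p for the
   probability with density m, and Qs for its second marginal, P * N(0, eps/2).
   If a coupling q of P and Q has density r and finite cost, then, since
   ln m = ln rP(x) - (d/2) ln(pi eps) - |x - y|^2 / eps, the objective at q is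
   c0 + eps KL(r | m), where c0 = eps (int ln rP dP - (d/2) ln(pi eps)) is its
   value at p.  Integrating r ln (r / (e^t m)) >= r - e^t m with t = s 1_B(y)
   gives KL(r | m) >= s Q(B) - (e^s - 1) Qs(B) for all s >= 0 and Borel B.  The
   case s = 0 shows that Qs is a minimizer.  The bound does not depend on q, so
   it passes to the infimum over couplings, attained or not: if the infimum for
   Q is c0, then s Q(B) <= (e^s - 1) Qs(B), and s -> 0 gives Q(B) <= Qs(B) for
   every B, hence Q = Qs by taking complements. *)

Require Import Defs.
From HB Require Import structures.
From mathcomp Require Import all_boot all_order all_algebra.
From mathcomp Require Import all_classical all_reals all_analysis.
From mathcomp Require Import measurable_realfun ring lra.
Import Order.TTheory GRing.Theory Num.Theory.
Local Open Scope classical_set_scope.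
Local Open Scope ring_scope.

Set Implicit Arguments.
Unset Strict Implicit.
Unset Printing Implicit Defensive.

(** * Integrals against densities *)

Section density.
Context d (T : measurableType d) (R : realType).
Local Open Scope ereal_scope.

(** The positive parts are ordered like [f] and [g], the negative parts the other way round. Stated
    for extended-valued functions of any sign because it is applied with [r ln r] on the right,
    whose integral may be infinite. *)
Lemma ae_le_integral (mu : {measure set T -> \bar R})
    (f g : T -> \bar R) :
  measurable_fun setT f -> measurable_fun setT g ->
  {ae mu, forall x, f x <= g x} ->
  \int[mu]_x f x <= \int[mu]_x g x.
Proof.
move=> mf mg fg; rewrite integralE [leRHS]integralE.
apply: leeB; apply: ae_ge0_le_integral => //.
- exact: measurable_funepos.
- exact: measurable_funepos.
- apply: filterS fg => x fgx _.
  rewrite !funeposE ge_max; apply/andP; split; last by rewrite le_max lexx orbT.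
  by rewrite le_max fgx.
- exact: measurable_funeneg.
- exact: measurable_funeneg.
- apply: filterS fg => x fgx _.
  rewrite !funenegE ge_max; apply/andP; split; last by rewrite le_max lexx orbT.
  by rewrite le_max leeN2 fgx.
Qed.

Lemma density_probability (mu : {measure set T -> \bar R}) (f : T -> R) :
  measurable_fun setT f -> (forall x, 0 <= f x)%R ->
  \int[mu]_x (f x)%:E = 1 ->
  exists p : probability T R,
    forall A, measurable A -> p A = \int[mu]_(x in A) (f x)%:E.
Proof.
move=> mf f0 f1.
have mEf A : measurable_fun A (fun x => (f x)%:E).
  exact/measurable_EFinP/measurable_funTS.
pose nu A := \int[mu]_(x in A) (f x)%:E.
have nu0 : nu set0 = 0 by rewrite /nu integral_set0.
have nu_ge0 A : 0 <= nu A by apply: integral_ge0 => x _; rewrite lee_fin.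
have nu_sigma : semi_sigma_additive nu.
  move=> F mF tF mUF; rewrite /nu ge0_integral_bigcup//.
  - by apply: is_cvg_ereal_nneg_natsum_cond => n _ _; exact: nu_ge0.
  - by move=> x _; rewrite lee_fin.
have nuM := isMeasure.Build _ T R nu nu0 nu_ge0 nu_sigma.
pose nuMeas : {measure set T -> \bar R} := HB.pack nu nuM.
have nuP := Measure_isProbability.Build _ T R nuMeas f1.
pose p : probability T R := HB.pack nu nuM nuP.
by exists p.
Qed.

(** [p] is absolutely continuous, and its Radon-Nikodym derivative is a.e. [f] because both
    integrate to [p A] over every measurable [A]. *)
Lemma ge0_integral_density (mu : {sigma_finite_measure set T -> \bar R})
    (p : probability T R) (f : T -> R) (g : T -> \bar R) :
  measurable_fun setT f -> (forall x, 0 <= f x)%R ->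
  (forall A, measurable A -> p A = \int[mu]_(x in A) (f x)%:E) ->
  measurable_fun setT g -> (forall x, 0 <= g x) ->
  \int[p]_x g x = \int[mu]_x (g x * (f x)%:E).
Proof.
move=> mf f0 pf mg g0.
have mEf A : measurable_fun A (fun x => (f x)%:E).
  exact/measurable_EFinP/measurable_funTS.
have pmu : p `<< mu.
  apply/null_content_dominatesP => A mA A0.
  by rewrite pf// null_set_integral.
rewrite -(Radon_Nikodym_SigmaFinite.change_of_variables pmu)//.
have intRN := Radon_Nikodym_SigmaFinite.f_integrable pmu.
apply: ae_eq_integral => //.
- by apply: emeasurable_funM => //; exact: measurable_int intRN.
- exact: emeasurable_funM.
- apply: ae_eqe_mul2l; apply: integral_ae_eq => // E _ mE.
  by rewrite -pf// -Radon_Nikodym_SigmaFinite.f_integral.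
Qed.

Lemma integrable_density (mu : {sigma_finite_measure set T -> \bar R})
    (p : probability T R) (f : T -> R) (g : T -> \bar R) :
  measurable_fun setT f -> (forall x, 0 <= f x)%R ->
  (forall A, measurable A -> p A = \int[mu]_(x in A) (f x)%:E) ->
  p.-integrable setT g ->
  mu.-integrable setT (fun x => g x * (f x)%:E).
Proof.
move=> mf f0 pf /integrableP[mg goo]; apply/integrableP; split.
  by apply: emeasurable_funM => //; exact/measurable_EFinP.
rewrite (ge0_integral_density mf f0 pf (g := fun x => `|g x|)) in goo => //.
  rewrite (eq_integral (fun x => `|g x| * (f x)%:E))// => x _.
  by rewrite abseM abse_EFin ger0_norm.
exact: measurableT_comp.
Qed.

Lemma integral_density (mu : {sigma_finite_measure set T -> \bar R})
    (p : probability T R) (f : T -> R) (g : T -> \bar R) :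
  measurable_fun setT f -> (forall x, 0 <= f x)%R ->
  (forall A, measurable A -> p A = \int[mu]_(x in A) (f x)%:E) ->
  p.-integrable setT g ->
  \int[p]_x g x = \int[mu]_x (g x * (f x)%:E).
Proof.
move=> mf f0 pf /[dup] gi /integrableP[mg _].
(* Multiplying by [f >= 0] commutes with taking positive and negative parts, which reduces to the
   nonnegative case. *)
rewrite integralE [RHS]integralE; congr (_ - _).
  rewrite (ge0_integral_density mf f0 pf)//; last exact: measurable_funepos.
  apply: eq_integral => x _.
  rewrite !funeposE; case: (leP (g x) 0) => gx.
    by rewrite mul0e max_r// mule_le0_ge0// lee_fin.
  by rewrite max_l// mule_ge0 ?lee_fin// ltW.
rewrite (ge0_integral_density mf f0 pf)//; last exact: measurable_funeneg.
apply: eq_integral => x _; rewrite !funenegE -mulNe.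
case: (leP (- g x) 0) => gx.
  by rewrite mul0e max_r// mule_le0_ge0// lee_fin.
by rewrite max_l// mule_ge0 ?lee_fin// ltW.
Qed.

End density.

(** * Lebesgue measure on tuples *)

Section lebesgue_tuple.
Context (R : realType) (d : nat).
Notation T := (d.-tuple R).
Implicit Types (mu : {measure set T -> \bar R}) (x y : T).

Lemma measurable_tadd (x : T) : measurable_fun setT (tadd x).
Proof.
apply/measurable_fun_tnthP => i.
rewrite (_ : _ \o _ = fun z => tnth x i + tnth z i); last first.
  by apply/funext => z /=; rewrite tnth_mktuple.
by apply: measurable_funD => //; exact: measurable_tnth.
Qed.

Lemma measurable_box (a b : 'I_d -> R) : measurable (box a b).
Proof.
rewrite (_ : box a b =
    \big[setI/setT]_(i < d) (@tnth d R ^~ i @^-1` `[a i, b i]%classic)).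
  apply: bigsetI_measurable => i _; rewrite -[X in measurable X]setTI.
  by apply: measurable_tnth => //; exact: measurable_itv.
rewrite -bigcap_seq; apply/seteqP; split => x /= Hx i; last first.
  by have := Hx i (mem_index_enum i); rewrite /= in_itv.
by move=> _ /=; rewrite in_itv /=.
Qed.

Lemma bigcup_box :
  \bigcup_n box (fun _ : 'I_d => - n%:R) (fun _ => n%:R) = [set: T].
Proof.
apply/seteqP; split => // x _.
have [n xn] : exists n, forall i, `|tnth x i| <= n%:R.
  exists (\max_(i < d) (Num.truncn `|tnth x i|).+1) => i.
  apply: le_trans (ltW (truncnS_gt _)) _.
  by rewrite ler_nat (@leq_bigmax _ (fun i => (Num.truncn `|tnth x i|).+1) i).
by exists n => //= i; rewrite -ler_norml.
Qed.

Lemma boxI (a b a' b' : 'I_d -> R) :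
  box a b `&` box a' b' =
  box (fun i => Num.max (a i) (a' i)) (fun i => Num.min (b i) (b' i)) :> set T.
Proof.
apply/seteqP; split => x /=.
  move=> [h h'] i; have /andP[? ?] := h i; have /andP[? ?] := h' i.
  by rewrite ge_max le_min; apply/andP; split; apply/andP.
move=> h; split=> i; have := h i; rewrite ge_max le_min => /andP[/andP[? ?]];
  by move=> /andP[? ?]; apply/andP.
Qed.

Lemma measurable_g_box :
  @measurable _ T = <<s [set A | exists a b : 'I_d -> R, A = box a b] >>.
Proof.
set G := [set A | _]; apply/seteqP; split; last first.
  apply: smallest_sub; first exact: sigma_algebra_measurable.
  by move=> _ [a [b ->]]; exact: measurable_box.
apply: smallest_sub; first exact: smallest_sigma_algebra.
rewrite -bigcup_seq; apply: bigcup_sub => i _.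
move=> _ [A mA <-].
have mE : @measurable _ R = <<s @RGenCInfty.G R >>.
  exact: RGenCInfty.measurableE.
have {mA} : <<s @RGenCInfty.G R >> A by rewrite -mE.
have sGi := @sigma_algebra_image _ _ setT (@tnth d R ^~ i) _
  (@smallest_sigma_algebra T setT G).
move: A; apply: smallest_sub => //.
move=> _ [x ->]; rewrite /image_set_system /= setTI.
(* The half-space [x <= tnth y i] is exhausted by cubes cut off below at [x] in direction [i]. *)
rewrite (_ : _ @^-1` _ = \bigcup_n box
    (fun j => if j == i then Num.max (- n%:R) x else - n%:R) (fun=> n%:R)).
  apply: sigma_algebra_bigcup => n; apply: sub_sigma_algebra; rewrite /G/=.
  by exists (fun j => if j == i then Num.max (- n%:R) x else - n%:R), (fun=> n%:R).
apply/seteqP; split => y /=.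
  rewrite in_itv /= andbT => xy.
  have [n _ yn] : (\bigcup_n box (fun _ : 'I_d => - n%:R) (fun _ => n%:R)) y.
    by rewrite bigcup_box.
  exists n => //= j; case: eqP => [->|_]; last exact: yn.
  by have /andP[? ?] := yn i; rewrite ge_max; apply/andP; split=> //; apply/andP.
move=> [n _ yn]; have := yn i; rewrite eqxx ge_max => /andP[/andP[_ ?] _].
by rewrite in_itv /= andbT.
Qed.

Lemma box_eq0 (a b : 'I_d -> R) :
  ~ (forall i, a i <= b i) -> box a b = set0 :> set T.
Proof.
move=> nab; apply/seteqP; split => // x /= xab; apply: nab => i.
by have /andP[] := xab i; exact: le_trans.
Qed.

(** Boxes form a generating pi-system and the cubes of side [2n], of finite measure, exhaust the
    space. *)
Lemma is_lebesgue_unique mu mu' : is_lebesgue mu -> is_lebesgue mu' ->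
  forall A, measurable A -> mu A = mu' A.
Proof.
move=> lmu lmu'.
apply: (measure_unique _ _ measurable_g_box _ _ bigcup_box) => //.
- move=> _ _ [a [b ->]] [a' [b' ->]]; rewrite boxI.
  by eexists; eexists; reflexivity.
- by move=> n; eexists; eexists; reflexivity.
(* [is_lebesgue] speaks only of ordered corners; a box with unordered corners is empty. *)
- move=> _ [a [b ->]]; have [ab|nab] := pselect (forall i, a i <= b i).
    by rewrite lmu// lmu'.
  by rewrite box_eq0// !measure0.
- move=> n; rewrite lmu ?ltry// => i.
  by rewrite (@le_trans _ _ 0) ?oppr_le0.
Qed.

Lemma is_lebesgue_sigma_finite mu : is_lebesgue mu -> sigma_finite setT mu.
Proof.
move=> lmu; exists (fun n => box (fun=> - n%:R) (fun=> n%:R)).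
  by rewrite bigcup_box.
move=> n; split; first exact: measurable_box.
rewrite lmu ?ltry// => i.
by rewrite (@le_trans _ _ 0) ?oppr_le0.
Qed.

Lemma is_lebesgue_translate mu x : is_lebesgue mu ->
  is_lebesgue (pushforward mu (tadd x)).
Proof.
move=> lmu a b ab; rewrite /pushforward.
rewrite (_ : _ @^-1` _ =
    box (fun i => a i - tnth x i) (fun i => b i - tnth x i)).
  rewrite lmu; last by move=> i; rewrite lerD2r.
  by congr (_%:E); apply: eq_bigr => i _; ring.
apply/seteqP; split => y /= h i; have := h i;
  by rewrite tnth_mktuple lerBlDl lerBrDl.
Qed.

Local Open Scope ereal_scope.

(** Translates of boxes are boxes of the same volume, so the image measure is again Lebesgue and
    uniqueness identifies it with [mu]. *)
Lemma ge0_integral_translate mu x (f : T -> \bar R) : is_lebesgue mu ->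
  measurable_fun setT f -> (forall z, 0 <= f z) ->
  \int[mu]_z f (tadd x z) = \int[mu]_z f z.
Proof.
move=> lmu mf f0; have mx := measurable_tadd x.
rewrite -[LHS]/(\int[mu]_(z in tadd x @^-1` setT) (f \o tadd x) z).
rewrite -(ge0_integral_pushforward mx)//.
apply: (eq_measure_integral mu) => A mA _ /=.
apply: (is_lebesgue_unique _ lmu) => //.
exact: is_lebesgue_translate.
Qed.

End lebesgue_tuple.

(** * Gaussian integrals *)

Section gaussian_integral.
Context (R : realType).
Local Open Scope ereal_scope.

Lemma measurable_expRNsqr (c : R) :
  measurable_fun setT (fun x : R => (expR (- (x ^+ 2 / c)))%:E).
Proof.
apply/measurable_EFinP; apply: measurableT_comp => //.
by apply: measurableT_comp => //; apply: measurable_funM.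
Qed.

Lemma integral_expRNsqr (c : R) : (0 < c)%R ->
  \int[lebesgue_measure]_x (expR (- (x ^+ 2 / c)))%:E = (Num.sqrt (pi * c))%:E.
Proof.
(* The standard deviation with [2 s^2 = c], so the integrand is an unnormalized normal density. *)
move=> c0; pose s : R := Num.sqrt (c / 2).
have s2 : (s ^+ 2 = c / 2)%R by rewrite sqr_sqrtr// divr_ge0// ltW.
have s0 : s != 0%R by rewrite gt_eqF// sqrtr_gt0 divr_gt0.
have pic : (0 < Num.sqrt (pi * c))%R by rewrite sqrtr_gt0 mulr_gt0// pi_gt0.
have peakE : normal_peak s = ((Num.sqrt (pi * c))^-1)%R.
  by rewrite /normal_peak s2; congr (_^-1)%R; congr Num.sqrt; field.
have pdfE : normal_pdf 0 s =
    (fun x => (Num.sqrt (pi * c))^-1 * expR (- (x ^+ 2 / c)))%R.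
  apply/funext => x; rewrite normal_pdfE// peakE /normal_fun s2 subr0 mulNr.
  by congr (_ * expR _)%R; congr (- _)%R; congr (_ * _^-1)%R; field.
have := integral_normal_pdf 0%R s; rewrite pdfE.
under eq_integral do rewrite EFinM.
rewrite ge0_integralZl//; first last.
  exact: measurable_expRNsqr.
move=> /(congr1 (fun x => (Num.sqrt (pi * c))%:E * x)).
by rewrite muleA -EFinM divff ?gt_eqF// mul1e mule1.
Qed.

(* [lebesgue_measure] is a measure on [measurableTypeR R], whose display differs
   from that of [R]. *)
Definition tcons n (z : measurableTypeR R * n.-tuple R) : n.+1.-tuple R :=
  [tuple of z.1 :: z.2].

Lemma measurable_tcons n : measurable_fun setT (@tcons n).
Proof. exact: measurable_cons. Qed.

Lemma measurable_sqnorm n : measurable_fun setT (@sqnorm R n).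
Proof.
rewrite /sqnorm; apply: measurable_sum => i.
by apply: measurable_funX; exact: measurable_tnth.
Qed.

Lemma measurable_expRNsqnorm n (c : R) :
  measurable_fun setT (fun x : n.-tuple R => (expR (- (sqnorm x / c)))%:E).
Proof.
apply/measurable_EFinP; apply: measurableT_comp => //.
apply: measurableT_comp => //; apply: measurable_funM => //.
exact: measurable_sqnorm.
Qed.

Lemma lebesgue_tupleS n (la : {sigma_finite_measure set (n.-tuple R) -> \bar R}) :
  is_lebesgue la ->
  is_lebesgue (pushforward (lebesgue_measure \x la) (@tcons n)).
Proof.
move=> lla a b ab; rewrite /pushforward.
rewrite (_ : _ @^-1` _ = `[a ord0, b ord0]%classic `*`
    box (fun i => a (lift ord0 i)) (fun i => b (lift ord0 i))); last first.
  apply/seteqP; split => -[x y] /=.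
    move=> h; split; first by rewrite /= in_itv; exact: (h ord0).
    by move=> i; have := h (lift ord0 i); rewrite tnthS.
  rewrite in_itv /= => -[h0 h] i; case: (unliftP ord0 i) => [j ->|->//].
  by rewrite tnthS; exact: h.
rewrite product_measure1E; [|exact: (measurable_itv `[a ord0, b ord0])|exact: measurable_box].
rewrite lla; last by move=> i; exact: ab.
rewrite [X in X * _](lebesgue_measure_itv `[a ord0, b ord0])/= lte_fin big_ord_recl EFinM; congr (_ * _).
have := ab ord0; rewrite le_eqVlt => /orP[/eqP ->|ab0].
  by rewrite ltxx subrr.
by rewrite ab0.
Qed.

(** Tonelli: the exponential of a sum of squares splits into the factor of the first coordinate and
    that of the others. *)
Lemma integral_lebesgue_tupleS n
    (la : {sigma_finite_measure set (n.-tuple R) -> \bar R}) (c : R) :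
  (0 < c)%R ->
  \int[pushforward (lebesgue_measure \x la) (@tcons n)]_x
    (expR (- (sqnorm x / c)))%:E =
  (Num.sqrt (pi * c))%:E * \int[la]_x (expR (- (sqnorm x / c)))%:E.
Proof.
move=> c0; have mc := @measurable_tcons n.
rewrite (ge0_integral_pushforward mc)//; last exact: measurable_expRNsqnorm.
rewrite preimage_setT fubini_tonelli1//; first last.
- by move=> z; rewrite /= lee_fin expR_ge0.
- exact: measurableT_comp (measurable_expRNsqnorm c) mc.
rewrite -integral_expRNsqr// -ge0_integralZr//; last 2 first.
- exact: measurable_expRNsqr.
- exact: integral_ge0.
apply: eq_integral => x _; rewrite /fubini_F -ge0_integralZl//; last first.
  exact: measurable_expRNsqnorm.
apply: eq_integral => y _.
rewrite -EFinM -expRD /= /sqnorm big_ord_recl /=.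
rewrite (eq_bigr (fun i => tnth y i ^+ 2)%R); last by move=> i _; rewrite tnthS.
by rewrite mulrDl opprD.
Qed.

(** One Lebesgue measure is built by induction, adding a coordinate at a time, and its Gaussian
    integral is computed along the way; uniqueness then carries the value to any [mu]. *)
Lemma lebesgue_tuple_exists n :
  exists2 la : {sigma_finite_measure set (n.-tuple R) -> \bar R},
    is_lebesgue la &
    forall c : R, (0 < c)%R ->
    \int[la]_x (expR (- (sqnorm x / c)))%:E = ((pi * c) `^ (n%:R / 2))%:E.
Proof.
elim: n => [|n [la lla ila]].
  (* In dimension 0 the only box is the whole one-point space, of volume the empty product 1. *)
  exists (dirac [tuple]).
    move=> a b _; rewrite big_ord0 /= diracE mem_set// => -[]//.
  move=> c c0; rewrite integral_dirac//; last exact: measurable_expRNsqnorm.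
  by rewrite diracT mul1e /sqnorm big_ord0 mul0r oppr0 expR0 mul0r powRr0.
have mc := @measurable_tcons n.
pose nu : {measure set (n.+1.-tuple R) -> \bar R} :=
  measure_function_pushforward__canonical__measure_function_Measure
    (lebesgue_measure \x la) mc.
have lnu : is_lebesgue nu := lebesgue_tupleS lla.
have nusf := Measure_isSigmaFinite.Build _ _ _ nu (is_lebesgue_sigma_finite lnu).
pose nu' : {sigma_finite_measure set (n.+1.-tuple R) -> \bar R} :=
  HB.pack (Measure.sort nu) nusf.
exists nu'; first exact: lnu.
move=> c c0; rewrite [LHS]integral_lebesgue_tupleS// ila// -EFinM.
have pc0 : (0 < pi * c)%R by rewrite mulr_gt0// pi_gt0.
rewrite -powR12_sqrt ?ltW// -powRD ?gt_eqF ?implybT//.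
by congr (_ `^ _)%:E; rewrite -natr1; field.
Qed.

Lemma integral_expRNsqnorm n (mu : {measure set (n.-tuple R) -> \bar R}) (c : R) :
  is_lebesgue mu -> (0 < c)%R ->
  \int[mu]_x (expR (- (sqnorm x / c)))%:E = ((pi * c) `^ (n%:R / 2))%:E.
Proof.
move=> lmu c0; have [la lla <-//] := lebesgue_tuple_exists n.
by apply: (eq_measure_integral la) => A mA _; exact: is_lebesgue_unique.
Qed.

End gaussian_integral.

(** * Integrable functions with a known real integral *)

Section has_integral.
Context d (T : measurableType d) (R : realType).
Implicit Types (mu : {measure set T -> \bar R}) (p : probability T R).
Implicit Types (f g : T -> R) (u v : R).

(** Bundling integrability with a real value lets linear combinations be evaluated in [R], away from
    infinities. *)
Definition has_integral mu f v : Prop :=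
  mu.-integrable setT (fun x => (f x)%:E) /\ (\int[mu]_x (f x)%:E = v%:E)%E.

Lemma has_integralD mu f g u v : has_integral mu f u -> has_integral mu g v ->
  has_integral mu (fun x => f x + g x) (u + v).
Proof.
move=> [fi fu] [gi gv]; split; first exact: integrableD fi gi.
by rewrite EFinD -fu -gv -integralD.
Qed.

Lemma has_integralZ mu f v c : has_integral mu f v ->
  has_integral mu (fun x => c * f x) (c * v).
Proof.
move=> [fi fv]; split; first exact: integrableZl fi.
by rewrite EFinM -fv -integralZl.
Qed.

Lemma has_integralB mu f g u v : has_integral mu f u -> has_integral mu g v ->
  has_integral mu (fun x => f x - g x) (u - v).
Proof.
move=> fu /(has_integralZ (-1)) gv.
have := has_integralD fu gv; rewrite mulN1r.
by under eq_fun do rewrite mulN1r.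
Qed.

Lemma has_integral_cst p v : has_integral p (fun=> v) v.
Proof.
split; first exact: finite_measure_integrable_cst.
by rewrite integral_cst// [X in (_ * X)%E](probability_setT p) mule1.
Qed.

Lemma has_integral_indic p A : measurable A ->
  has_integral p \1_A (fine (p A)).
Proof.
move=> mA; split; first exact: integrable_indic.
by rewrite integral_indic// setIT fineK// fin_num_measure.
Qed.

Lemma has_integral_ge0 mu f : measurable_fun setT f -> (forall x, 0 <= f x) ->
  (\int[mu]_x (f x)%:E < +oo)%E ->
  has_integral mu f (fine (\int[mu]_x (f x)%:E)).
Proof.
move=> mf f0 foo; split.
  apply/integrableP; split; first exact/measurable_EFinP.
  by under eq_integral do rewrite abse_EFin ger0_norm//.
by rewrite fineK// ge0_fin_numE// integral_ge0// => x _; rewrite lee_fin.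
Qed.

Lemma has_integral_density (mu : {sigma_finite_measure set T -> \bar R})
    p f g v :
  measurable_fun setT f -> (forall x, 0 <= f x) ->
  (forall A, measurable A -> p A = \int[mu]_(x in A) (f x)%:E)%E ->
  has_integral p g v -> has_integral mu (fun x => g x * f x) v.
Proof.
move=> mf f0 pf [gi gv]; split; first exact: integrable_density pf gi.
by rewrite -gv (integral_density mf f0 pf gi).
Qed.

End has_integral.

(** Change of variables; with [phi = fst] it integrates a function of [x] against a coupling through
    its first marginal. *)
Lemma has_integral_pushforward d d' (T : measurableType d)
    (T' : measurableType d') (R : realType) (phi : T -> T')
    (mu : {measure set T -> \bar R}) (nu : {measure set T' -> \bar R})
    (f : T' -> R) (v : R) :
  measurable_fun setT phi ->
  (forall A, measurable A -> mu (phi @^-1` A) = nu A) ->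
  has_integral nu f v -> has_integral mu (f \o phi) v.
Proof.
move=> mphi munu [/integrableP[mf foo] fv].
have nuE (h : T' -> \bar R) :
    (\int[pushforward mu phi]_x h x = \int[nu]_x h x)%E.
  by apply: (eq_measure_integral nu) => A mA _; exact: munu.
have fi : mu.-integrable setT ((fun x => (f x)%:E) \o phi).
  apply/integrableP; split; first exact: measurableT_comp.
  move: foo; rewrite -nuE ge0_integral_pushforward//.
  exact: measurableT_comp.
split=> //; rewrite -fv -nuE; apply/esym.
by rewrite (integral_pushforward mphi)// preimage_setT.
Qed.

(** * The Gaussian transition kernel and its second moment *)

Section gauss_kernel.
Context (R : realType) (d : nat).
Notation T := (d.-tuple R).
Variables (mu : {sigma_finite_measure set T -> \bar R}) (Hmu : is_lebesgue mu).
Variables (eps : R) (heps : 0 < eps).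

Definition gauss_kernel (z : T * T) : R :=
  (pi * eps) `^ (- (d%:R / 2)) * expR (- (sqdist z.1 z.2 / eps)).

Lemma gauss_kernel_gt0 z : 0 < gauss_kernel z.
Proof. by rewrite mulr_gt0 ?expR_gt0// powR_gt0// mulr_gt0// pi_gt0. Qed.

Lemma gauss_density_gt0 (x : T) : 0 < gauss_density eps x.
Proof. by rewrite mulr_gt0 ?expR_gt0// powR_gt0// mulr_gt0// pi_gt0. Qed.

Lemma ln_gauss_kernel z :
  ln (gauss_kernel z) = - (d%:R / 2 * ln (pi * eps)) - sqdist z.1 z.2 / eps.
Proof.
rewrite /gauss_kernel lnM ?posrE ?expR_gt0 ?powR_gt0 ?mulr_gt0 ?pi_gt0//.
by rewrite ln_powR expRK mulNr.
Qed.

Lemma sqdist_tadd (x z : T) : sqdist x (tadd x z) = sqnorm z.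
Proof. by apply: eq_bigr => i _; rewrite tnth_mktuple; ring. Qed.

Lemma gauss_kernel_tadd (x z : T) :
  gauss_kernel (x, tadd x z) = gauss_density eps z.
Proof. by rewrite /gauss_kernel sqdist_tadd. Qed.

Lemma sqdist_ge0 (x y : T) : 0 <= sqdist x y.
Proof. by apply: sumr_ge0 => i _; exact: sqr_ge0. Qed.

Lemma sqnorm_ge0 (x : T) : 0 <= sqnorm x.
Proof. by apply: sumr_ge0 => i _; exact: sqr_ge0. Qed.

Lemma measurable_sqdist : measurable_fun setT (fun z : T * T => sqdist z.1 z.2).
Proof.
apply: measurable_sum => i; apply: measurable_funX; apply: measurable_funB.
  exact: (measurableT_comp (measurable_tnth i) measurable_fst).
exact: (measurableT_comp (measurable_tnth i) measurable_snd).
Qed.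

Lemma measurable_gauss_kernel : measurable_fun setT gauss_kernel.
Proof.
apply: measurable_funM => //; apply: measurableT_comp => //.
apply: measurableT_comp => //; apply: measurable_funM => //.
exact: measurable_sqdist.
Qed.

Lemma measurable_gauss_density : measurable_fun setT (@gauss_density R d eps).
Proof.
apply: measurable_funM => //; apply: measurableT_comp => //.
apply: measurableT_comp => //; apply: measurable_funM => //.
exact: measurable_sqnorm.
Qed.

Local Open Scope ereal_scope.

Lemma integral_gauss_density : \int[mu]_z (gauss_density eps z)%:E = 1.
Proof.
under eq_integral do rewrite EFinM.
rewrite ge0_integralZl//; last 2 first.
- exact: measurable_expRNsqnorm.
- by rewrite lee_fin powR_ge0.
rewrite integral_expRNsqnorm// -EFinM powRN mulVf// gt_eqF// powR_gt0//.
by rewrite mulr_gt0// pi_gt0.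
Qed.

Lemma integral_sqnorm_gauss_density_lty :
  \int[mu]_z (sqnorm z * gauss_density eps z)%:E < +oo.
Proof.
(* With [u = |z|^2 / (2 eps)], [u e^(-2u) <= e^(-u)]. *)
pose c : R := ((pi * eps) `^ (- (d%:R / 2)) * (2 * eps))%R.
have c0 : (0 <= c)%R by rewrite mulr_ge0 ?powR_ge0// mulr_ge0// ltW.
apply: (@le_lt_trans _ _
    (\int[mu]_z (c%:E * (expR (- (sqnorm z / (2 * eps))))%:E))).
  apply: ge0_le_integral => //.
  - by move=> z _; rewrite lee_fin mulr_ge0 ?sqnorm_ge0// ltW// gauss_density_gt0.
  - apply/measurable_EFinP; apply: measurable_funM; first exact: measurable_sqnorm.
    exact: measurable_gauss_density.
  - by apply: emeasurable_funM => //; exact: measurable_expRNsqnorm.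
  - move=> z _; rewrite -EFinM lee_fin /gauss_density /c.
    set u := (sqnorm z / (2 * eps))%R.
    have -> : sqnorm z = (u * (2 * eps))%R.
      by rewrite /u divfK// gt_eqF// mulr_gt0.
    have -> : (- (u * (2 * eps) / eps) = - u - u)%R.
      by field; rewrite gt_eqF.
    rewrite expRD (_ : (_ * _ = c * (u * expR (- u) * expR (- u)))%R); last first.
      by rewrite /c; ring.
    rewrite ler_wpM2l// ler_piMl ?expR_ge0//.
    rewrite expRN ler_pdivrMr ?expR_gt0// mul1r.
    by apply: le_trans (expR_ge1Dx _); rewrite lerDr.
rewrite ge0_integralZl//; last exact: measurable_expRNsqnorm.
by rewrite integral_expRNsqnorm ?mulr_gt0// -EFinM ltry.
Qed.

(** Substitute [y = x + z] and use translation invariance of [mu]. *)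
Lemma ge0_integral_gauss_kernel (x : T) (F : T -> \bar R) :
  measurable_fun setT F -> (forall y, 0 <= F y) ->
  \int[mu]_y (F y * (gauss_kernel (x, y))%:E) =
  \int[mu]_z (F (tadd x z) * (gauss_density eps z)%:E).
Proof.
move=> mF F0.
rewrite -(ge0_integral_translate x Hmu); last 2 first.
- apply: emeasurable_funM => //; apply/measurable_EFinP.
  apply: (measurableT_comp measurable_gauss_kernel).
  exact: pair1_measurable.
- by move=> y; rewrite mule_ge0// lee_fin ltW// gauss_kernel_gt0.
by apply: eq_integral => z _; rewrite gauss_kernel_tadd.
Qed.

End gauss_kernel.

Lemma integral_indicT d (T : measurableType d) (R : realType)
    (mu : {measure set T -> \bar R}) (A : set T) : measurable A ->
  (\int[mu]_x (\1_A x)%:E = mu A)%E.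
Proof. by move=> mA; rewrite integral_indic// setIT. Qed.

(** * Sigma-finiteness of the product measure *)

Section square_measure.
Context d (T : measurableType d) (R : realType).
Variable mu : {sigma_finite_measure set T -> \bar R}.
Local Open Scope ereal_scope.

Lemma sigma_finite_square : sigma_finite setT (mu \x mu).
Proof.
(* The exhaustion is taken increasing, so that both coordinates of a point lie in a common [F n]. *)
have /sigma_finiteP[F [TF ndF Foo]] := sigma_finiteT mu.
exists (fun n => F n `*` F n).
  apply/seteqP; split => // -[x y] _.
  have [i _ Fx] : (\bigcup_n F n) x by rewrite -TF.
  have [j _ Fy] : (\bigcup_n F n) y by rewrite -TF.
  exists (maxn i j) => //; split => /=.
    by move: Fx; apply/subsetPset/ndF/leq_maxl.
  by move: Fy; apply/subsetPset/ndF/leq_maxr.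
move=> n; have [mF Fn] := Foo n; split; first exact: measurableX.
by rewrite product_measure1E// lte_mul_pinfty// ge0_fin_numE.
Qed.

(* Packed by hand: canonical inference finds the sigma-finite structure of
   [_ \x _] only for subprobabilities. *)
Definition square_measure : {sigma_finite_measure set (T * T)%type -> \bar R} :=
  HB.pack (mu \x mu)
    (Measure_isSigmaFinite.Build _ (T * T)%type R (mu \x mu) sigma_finite_square).

End square_measure.

(** * The Gibbs coupling *)

Section optimal_coupling.
Context (R : realType) (d : nat).
Notation T := (d.-tuple R).
Variables (mu : {sigma_finite_measure set T -> \bar R}) (Hmu : is_lebesgue mu).
Variables (eps : R) (heps : 0 < eps).
Variables (P : probability T R) (rP : T -> R).
Hypotheses (mrP : measurable_fun setT rP) (rP_ge0 : forall x, 0 <= rP x).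
Hypothesis PrP : forall A, measurable A -> P A = (\int[mu]_(x in A) (rP x)%:E)%E.

(** Joint density of [(X, X + Z)] with [X] of law [P] and [Z] an independent Gaussian. *)
Definition gibbs_density (z : T * T) : R := rP z.1 * gauss_kernel eps z.

Let k : T * T -> R := gauss_kernel eps.
Let k_gt0 z : 0 < k z. Proof. exact: gauss_kernel_gt0. Qed.
Let mk : measurable_fun setT k. Proof. exact: measurable_gauss_kernel. Qed.

Lemma gibbs_density_ge0 z : 0 <= gibbs_density z.
Proof. by rewrite mulr_ge0// ltW// k_gt0. Qed.

Lemma measurable_gibbs_density : measurable_fun setT gibbs_density.
Proof. by apply: measurable_funM => //; exact: measurableT_comp. Qed.

Local Open Scope ereal_scope.

(** Tonelli takes [rP x] out of the inner integral, where it turns [mu] into [P]; the inner integral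
    is then shifted by [x]. *)
Lemma ge0_integral_gibbs_density (F : T * T -> \bar R) :
  measurable_fun setT F -> (forall z, 0 <= F z) ->
  \int[mu \x mu]_z (F z * (gibbs_density z)%:E) =
  \int[P]_x \int[mu]_z (F (x, tadd x z) * (gauss_density eps z)%:E).
Proof.
move=> mF F0; pose G x := \int[mu]_y (F (x, y) * (k (x, y))%:E).
have mFk : measurable_fun setT (fun z => F z * (k z)%:E).
  by apply: emeasurable_funM => //; exact/measurable_EFinP.
have Fk0 z : 0 <= F z * (k z)%:E by rewrite mule_ge0// lee_fin ltW.
have mG : measurable_fun setT G.
  exact: (measurable_fun_fubini_tonelli_F (fun z => F z * (k z)%:E)).
have G0 x : 0 <= G x by exact: integral_ge0.
rewrite fubini_tonelli1; last 2 first.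
- apply: emeasurable_funM => //; apply/measurable_EFinP.
  exact: measurable_gibbs_density.
- by move=> z; rewrite mule_ge0// lee_fin gibbs_density_ge0.
transitivity (\int[mu]_x (G x * (rP x)%:E)).
  apply: eq_integral => x _; rewrite -ge0_integralZr//; last first.
  - by rewrite lee_fin.
  - exact: (measurableT_comp mFk (pair1_measurable x)).
  apply: eq_integral => y _; rewrite /gibbs_density /= EFinM.
  by rewrite (muleC (rP x)%:E) muleA.
rewrite -(ge0_integral_density mrP rP_ge0 PrP mG G0).
apply: eq_integral => x _.
apply: (ge0_integral_gauss_kernel Hmu heps x (F := fun y => F (x, y))) => //.
exact: (measurableT_comp mF (pair1_measurable x)).
Qed.

Lemma gibbs_probability : exists p : probability (T * T)%type R,
  forall A, measurable A -> p A = \int[mu \x mu]_(z in A) (gibbs_density z)%:E.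
Proof.
apply: density_probability; first exact: measurable_gibbs_density.
  exact: gibbs_density_ge0.
transitivity (\int[mu \x mu]_z (1 * (gibbs_density z)%:E)).
  by apply: eq_integral => z _; rewrite mul1e.
rewrite (ge0_integral_gibbs_density (F := fun=> 1))//.
transitivity (\int[P]_x (cst 1 x : \bar R)).
  apply: eq_integral => x _; rewrite -[RHS](integral_gauss_density Hmu heps).
  by apply: eq_integral => z _; rewrite mul1e.
by rewrite integral_cst// mul1e [LHS](probability_setT P).
Qed.

Variable p : probability (T * T)%type R.
Hypothesis pE : forall A, measurable A ->
  p A = \int[mu \x mu]_(z in A) (gibbs_density z)%:E.

Lemma ge0_integral_gibbs (F : T * T -> \bar R) :
  measurable_fun setT F -> (forall z, 0 <= F z) ->
  \int[p]_z F z =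
  \int[P]_x \int[mu]_z (F (x, tadd x z) * (gauss_density eps z)%:E).
Proof.
move=> mF F0; rewrite -(ge0_integral_gibbs_density mF F0).
exact: (ge0_integral_density (mu := square_measure mu)
  measurable_gibbs_density gibbs_density_ge0 pE mF F0).
Qed.

Lemma gibbs_marginal1 (A : set T) : measurable A -> p (A `*` setT) = P A.
Proof.
move=> mA; have mAT : measurable (A `*` [set: T]) by exact: measurableX.
rewrite -integral_indicT// ge0_integral_gibbs; last 2 first.
- by apply/measurable_EFinP; exact: measurable_indic.
- by move=> z; rewrite lee_fin.
rewrite -[RHS]integral_indicT//; apply: eq_integral => x _.
transitivity (\int[mu]_z ((\1_A x)%:E * (gauss_density eps z)%:E)).
  apply: eq_integral => z _; congr (_%:E * _).
  by rewrite !indicE; congr (nat_of_bool _)%:R; apply/idP/idP;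
    rewrite !inE => // -[].
rewrite ge0_integralZl//; last first.
- by move=> z _; rewrite lee_fin ltW// gauss_density_gt0.
- by apply/measurable_EFinP; exact: measurable_gauss_density.
by rewrite integral_gauss_density// mule1.
Qed.

(** For the indicator of [y] in [B], the disintegration formula is literally the definition of
    [conv_gauss]. *)
Lemma gibbs_marginal2 (B : set T) : measurable B ->
  p (setT `*` B) = conv_gauss mu eps P B.
Proof.
move=> mB; have mTB : measurable ([set: T] `*` B) by exact: measurableX.
rewrite -integral_indicT// ge0_integral_gibbs; last 2 first.
- by apply/measurable_EFinP; exact: measurable_indic.
- by move=> z; rewrite lee_fin.
apply: eq_integral => x _; apply: eq_integral => z _.
rewrite -EFinM; congr ((_ * _)%:E).
by rewrite !indicE; congr (nat_of_bool _)%:R; apply/idP/idP;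
    rewrite !inE => // -[].
Qed.

(** The displacement [y - x] is Gaussian for every [x], so the cost is the Gaussian second
    moment. *)
Lemma gibbs_cost_lty : \int[p]_z (sqdist z.1 z.2)%:E < +oo.
Proof.
rewrite ge0_integral_gibbs; last 2 first.
- by apply/measurable_EFinP; exact: measurable_sqdist.
- by move=> z; rewrite lee_fin sqdist_ge0.
under eq_integral => x _.
  under eq_integral do rewrite /= sqdist_tadd -EFinM.
  over.
rewrite integral_cst//= probability_setT mule1.
exact: integral_sqnorm_gauss_density_lty.
Qed.

End optimal_coupling.

(** * Variational bounds *)

Section entropic_bounds.
Context (R : realType).
Local Open Scope ereal_scope.

Lemma lee_dual_adde (c l : R) (y : \bar R) :
  l%:E <= y -> (c + l)%:E <= dual_adde c%:E y.
Proof.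
by case: y => [y| |]; rewrite /dual_adde ?leey// !lee_fin lerD2l.
Qed.

Lemma dual_adde_le (c u : R) (y : \bar R) :
  y <= u%:E -> dual_adde c%:E y <= (c + u)%:E.
Proof.
by case: y => [y| |]; rewrite /dual_adde ?leNye// !lee_fin lerD2l.
Qed.

Local Open Scope ring_scope.

(** Convexity: the left side is the tangent line of [r ln r] at the tilted value [e^t M]. *)
Lemma mul_ln_ge (r M t : R) : 0 <= r -> 0 < M ->
  r * (ln M + t + 1) - expR t * M <= r * ln r.
Proof.
move=> r0 M0; move: r0; rewrite le_eqVlt => /predU1P[<-|r0].
  by rewrite !mul0r sub0r oppr_le0 mulr_ge0 ?expR_ge0// ltW.
(* [ln u <= u - 1] with [u = e^t M / r]. *)
set u := expR t * M / r.
have u0 : 0 < u by rewrite divr_gt0// mulr_gt0// expR_gt0.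
have : ln u <= u - 1.
  have u1 : -1 < u - 1 by lra.
  by have := le_ln1Dx u1; rewrite (_ : 1 + (u - 1) = u)//; ring.
rewrite {1}/u ln_div ?posrE ?mulr_gt0 ?expR_gt0// lnM ?posrE ?expR_gt0// expRK.
rewrite -(ler_pM2l r0) => h.
have <- : r * u = expR t * M by rewrite /u; field; rewrite gt_eqF.
lra.
Qed.

Lemma le_of_expR_bound (q q' : R) : q <= 1 ->
  (forall s, 0 <= s -> s * q <= (expR s - 1) * q') -> 0 <= q' -> q <= q'.
Proof.
move=> q1 h q'0; rewrite leNgt; apply/negP => qq'.
(* Since [(1 - s)(e^s - 1) <= s], the hypothesis yields [(1 - s) q <= q'], so [q - q' <= s q <= s].
   Half the gap contradicts this, so a single [s] replaces the limit. *)
pose s := (q - q') / 2.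
have s0 : 0 < s by rewrite divr_gt0// subr_gt0.
have s1 : s < 1 by rewrite /s; lra.
have es : (1 - s) * expR s <= 1.
  by rewrite -ler_pdivlMr ?expR_gt0// mul1r -expRN; exact: expR_ge1Dx.
have es' : (1 - s) * (expR s - 1) <= s by lra.
have : s * ((1 - s) * q) <= s * q'.
  rewrite mulrCA; apply: le_trans (ler_wpM2l _ (h s (ltW s0))) _; first by lra.
  by rewrite mulrA ler_wpM2r.
rewrite ler_pM2l// leNgt => /negP; apply.
have : s * q <= s by rewrite ler_piMr// ltW.
by rewrite /s; lra.
Qed.

End entropic_bounds.

(** * Entropy and objective compared with the Gibbs coupling *)

Section gibbs_variational.
Context (R : realType) (d : nat).
Notation T := (d.-tuple R).
Variables (mu : {sigma_finite_measure set T -> \bar R}) (Hmu : is_lebesgue mu).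
Variables (eps : R) (heps : 0 < eps).
Variables (P : probability T R) (rP : T -> R).
Hypotheses (mrP : measurable_fun setT rP) (rP_ge0 : forall x, 0 <= rP x).
Hypothesis PrP : forall A, measurable A -> P A = (\int[mu]_(x in A) (rP x)%:E)%E.
Variable ent : R.
Hypothesis Pent : has_integral P (fun x => ln (rP x)) ent.
Variable p : probability (T * T)%type R.
Let m := gibbs_density eps rP.
Hypothesis pE : forall A, measurable A ->
  p A = (\int[mu \x mu]_(z in A) (m z)%:E)%E.

Let K : R := d%:R / 2 * ln (pi * eps).

(** Equals [ln (m z)] where [rP z.1 > 0]. As a sum of separately integrable terms, its integral
    against a coupling depends only on [ent] and the cost. *)
Let loggibbs (z : T * T) : R := ln (rP z.1) - (K + eps^-1 * sqdist z.1 z.2).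

Lemma has_integral_loggibbs (Q : probability T R) (q : probability (T * T)%type R)
    (c : R) : couplings P Q q ->
  has_integral q (fun z => sqdist z.1 z.2) c ->
  has_integral q loggibbs (ent - (K + eps^-1 * c)).
Proof.
move=> [qP _] qc; apply: has_integralB.
  apply: (has_integral_pushforward (phi := fst) (nu := P)) Pent => // A mA.
  rewrite -[RHS](qP A mA); congr (q _).
  by apply/seteqP; split=> -[x y] //= [].
by apply: has_integralD; [exact: has_integral_cst|exact: has_integralZ].
Qed.

(* Needed because [ln (rP z.1) = 0] is a junk value where [rP z.1 = 0]. *)
Lemma density_null (Q : probability T R) (q : probability (T * T)%type R) r :
  couplings P Q q -> is_density2 mu q r ->
  {ae (mu \x mu)%E, forall z, rP z.1 = 0 -> r z = 0}.
Proof.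
move=> [qP _] [mr [r0 qr]].
pose N := rP @^-1` [set 0].
have mN : measurable N by rewrite -[N]setTI; exact: mrP.
have mNT : measurable (N `*` [set: T]) by exact: measurableX.
(* This integral is [q (N * T) = P N], and [P N = 0] because the density of [P] vanishes on [N]. *)
have qN0 : (\int[mu \x mu]_(z in N `*` setT) `|(r z)%:E| = 0)%E.
  under eq_integral do rewrite abse_EFin ger0_norm//.
  rewrite -qr// qP// PrP//; apply: integral0_eq => x.
  by rewrite /N /= => ->.
move: qN0 => /ae_eq_integral_abs; case => //.
  by apply/measurable_EFinP; exact: measurable_funTS.
move=> X [mX X0 sX]; exists X; split => //.
apply: subset_trans sX => z /= hz h; apply: hz => z0.
by have [] : (r z)%:E = 0%E by exact: h.
Qed.

(** Integrates [mul_ln_ge] with [M = m z] and [t = s * one z] against Lebesgue measure; [q] carries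
    the terms in [r], [p] those in [m]. *)
Lemma le_entropy2 (Q : probability T R) (q : probability (T * T)%type R)
    (c s : R) (B : set T) : couplings P Q q ->
  has_integral q (fun z => sqdist z.1 z.2) c -> measurable B ->
  ((ent - (K + eps^-1 * c) + s * fine (Q B)
    - (expR s - 1) * fine (p (setT `*` B)))%:E <= entropy2 mu q)%E.
Proof.
move=> cq qc mB; apply/ereal_infP => _ [r dr <-].
have [mr [r0 qr]] := dr; have mTB : measurable ([set: T] `*` B) by exact: measurableX.
pose one := (\1_([set: T] `*` B) : T * T -> R).
have [_ qQ] := cq.
have hq : has_integral q (fun z => loggibbs z + s * one z + 1)
    (ent - (K + eps^-1 * c) + s * fine (Q B) + 1).
  apply: has_integralD (has_integral_cst _ _); apply: has_integralD.
    exact: has_integral_loggibbs cq qc.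
  by apply: has_integralZ; rewrite -qQ//; exact: has_integral_indic.
(* This integrand is [e^t], made affine in the indicator so that it integrates directly. *)
have hp : has_integral p (fun z => (expR s - 1) * one z + 1)
    ((expR s - 1) * fine (p (setT `*` B)) + 1).
  apply: has_integralD (has_integral_cst _ _).
  by apply: has_integralZ; exact: has_integral_indic.
have hqr := has_integral_density (mu := square_measure mu) mr r0 qr hq.
have hpm := has_integral_density (mu := square_measure mu)
  (measurable_gibbs_density eps mrP)
  (gibbs_density_ge0 heps rP_ge0) pE hp.
have [hi hv] := has_integralB hqr hpm.
(* The added ones are the total masses of [q] and [p], which cancel. *)
rewrite (_ : _ - _ = ent - (K + eps^-1 * c) + s * fine (Q B) + 1 -
  ((expR s - 1) * fine (p (setT `*` B)) + 1)); last by ring.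
rewrite -hv; apply: ae_le_integral.
- exact: measurable_int hi.
- apply/measurable_EFinP; apply: measurable_funM => //.
  exact: measurableT_comp (@measurable_ln R) mr.
apply: filterS (density_null cq dr) => z rz0; rewrite lee_fin.
have oneE : (expR s - 1) * one z + 1 = expR (s * one z).
  rewrite /one indicE; case: (_ \in _); first by rewrite !mulr1; ring.
  by rewrite !mulr0 expR0 add0r.
(* Where [rP] vanishes, so do [m] and, almost everywhere, [r]; both sides are then 0. *)
rewrite oneE; have [rP0|rP0] := eqVneq (rP z.1) 0.
  by rewrite rz0// mulr0 mul0r -/(m z) /m /gibbs_density rP0 mul0r mulr0 subr0.
have {}rP0 : 0 < rP z.1 by rewrite lt_def rP0 rP_ge0.
have mz0 : 0 < m z by rewrite mulr_gt0// gauss_kernel_gt0.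
have lnm : loggibbs z = ln (m z).
  rewrite /m /gibbs_density lnM ?posrE ?gauss_kernel_gt0// ln_gauss_kernel//.
  by rewrite /loggibbs /K opprD [eps^-1 * _]mulrC.
by rewrite lnm [X in X - _]mulrC; exact: mul_ln_ge.
Qed.

(** [m] is an admissible density, so it bounds the infimum defining [entropy2], and [m ln m] is [m]
    times [loggibbs] everywhere. *)
Lemma entropy2_gibbs (Q : probability T R) (c : R) :
  couplings P Q p ->
  has_integral p (fun z => sqdist z.1 z.2) c ->
  (entropy2 mu p <= (ent - (K + eps^-1 * c))%:E)%E.
Proof.
move=> cp pc; apply: ereal_inf_lbound; exists m.
  split; first exact: measurable_gibbs_density.
  by split=> //; exact: gibbs_density_ge0.
have hm := has_integral_density (mu := square_measure mu)
  (measurable_gibbs_density eps mrP)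
  (gibbs_density_ge0 heps rP_ge0) pE (has_integral_loggibbs cp pc).
rewrite -(proj2 hm); apply: eq_integral => z _; congr (_%:E).
rewrite mulrC -/m; have [rP0|rP0] := eqVneq (rP z.1) 0.
  by rewrite /m /gibbs_density rP0 !mul0r !mulr0.
have {}rP0 : 0 < rP z.1 by rewrite lt_def rP0 rP_ge0.
rewrite {2}/m /gibbs_density lnM ?posrE ?gauss_kernel_gt0// ln_gauss_kernel//.
by rewrite /loggibbs /K opprD [eps^-1 * _]mulrC.
Qed.

(** The cost [c] cancels against the term [- eps^-1 * c] of the entropy once this is scaled by
    [eps]; this constant remains. *)
Let c0 : R := eps * (ent - K).

Lemma le_eot_objective (Q : probability T R) (q : probability (T * T)%type R)
    (s : R) (B : set T) : couplings P Q q -> measurable B ->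
  ((c0 + eps * (s * fine (Q B) - (expR s - 1) * fine (p (setT `*` B))))%:E
    <= eot_objective mu eps q)%E.
Proof.
move=> cq mB; rewrite /eot_objective.
have mcost : measurable_fun setT (fun z : T * T => sqdist z.1 z.2).
  exact: measurable_sqdist.
have cost0 (z : T * T) : 0 <= sqdist z.1 z.2 by exact: sqdist_ge0.
have [qoo|] := ltP (\int[q]_z (sqdist z.1 z.2)%:E)%E +oo%E; last first.
  (* An infinite cost makes the objective [+oo] even for entropy [-oo], by the convention of
     [dual_adde]. *)
  by rewrite leye_eq => /eqP ->; case: (_ * _)%E => [?| |]; rewrite leey.
have qc := has_integral_ge0 mcost cost0 qoo.
have := le_entropy2 s cq qc mB.
rewrite (proj2 qc) /=; set c := fine _ => le_ent.
rewrite [X in (X%:E <= _)%E](_ : _ = c + eps * (ent - (K + eps^-1 * c) +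
  s * fine (Q B) - (expR s - 1) * fine (p (setT `*` B)))).
  by apply: lee_dual_adde; rewrite EFinM lee_pmul2l.
by rewrite /c0; field; rewrite gt_eqF.
Qed.

Lemma eot_objective_gibbs (Q : probability T R) :
  couplings P Q p -> (eot_objective mu eps p <= c0%:E)%E.
Proof.
move=> cp; rewrite /eot_objective.
have pc := has_integral_ge0 (@measurable_sqdist R d)
  (fun z => sqdist_ge0 z.1 z.2) (gibbs_cost_lty Hmu heps mrP rP_ge0 PrP pE).
have := entropy2_gibbs cp pc.
rewrite (proj2 pc) /=; set c := fine _ => ent_le.
rewrite [X in (_ <= X%:E)%E](_ : _ = c + eps * (ent - (K + eps^-1 * c))).
  by apply: dual_adde_le; rewrite EFinM lee_pmul2l.
by rewrite /c0; field; rewrite gt_eqF.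
Qed.

End gibbs_variational.

(** * Minimality and uniqueness of the Gaussian convolution *)

Unset Implicit Arguments.
Set Strict Implicit.

Theorem theorem3 (R : realType) (d : nat)
  (mu : {sigma_finite_measure set (d.-tuple R) -> \bar R})
  (Hmu : is_lebesgue mu)
  (eps : R) (heps : 0 < eps)
  (P : probability (d.-tuple R) R) (rP : d.-tuple R -> R)
  (mrP : measurable_fun setT rP) (rP_ge0 : forall x, 0 <= rP x)
  (PrP : forall A, measurable A -> P A = (\int[mu]_(x in A) (rP x)%:E)%E)
  (logrP : P.-integrable setT (fun x => (ln (rP x))%:E)) :
  exists Qs : probability (d.-tuple R) R,
    (forall A, measurable A -> Qs A = conv_gauss mu eps P A) /\
    (forall Q : probability (d.-tuple R) R,
        (W22eps mu eps P Qs <= W22eps mu eps P Q)%E) /\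
    (forall Q : probability (d.-tuple R) R,
        W22eps mu eps P Q = W22eps mu eps P Qs ->
        forall A, measurable A -> Q A = Qs A).
Proof.
have [p pE] := gibbs_probability Hmu heps mrP rP_ge0 PrP.
have msnd : measurable_fun [set: d.-tuple R * d.-tuple R] snd by [].
pose sndM : {mfun (d.-tuple R * d.-tuple R)%type >-> d.-tuple R} :=
  HB.pack snd (isMeasurableFun.Build _ _ _ _ _ msnd).
(* Taken as the law of the second coordinate under [p], so that it is a probability by construction;
   the convolution formula is recovered from [gibbs_marginal2]. *)
pose Qs : probability (d.-tuple R) R := distribution p sndM.
have QsE B : measurable B -> Qs B = p (setT `*` B).
  by move=> _; congr (p _); apply/seteqP; split=> -[x y] //= [].
have pQs : couplings P Qs p.
  split; first by move=> A mA; exact: (gibbs_marginal1 Hmu heps mrP rP_ge0 PrP pE).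
  by move=> B mB; rewrite QsE.
have Pent : has_integral P (fun x => ln (rP x)) (fine (\int[P]_x (ln (rP x))%:E)%E).
  by split=> //; rewrite fineK// integrable_fin_num.
set ent := fine _ in Pent.
pose c0 := eps * (ent - d%:R / 2 * ln (pi * eps)).
have leW (Q : probability (d.-tuple R) R) s B : measurable B ->
    ((c0 + eps * (s * fine (Q B) - (expR s - 1) * fine (Qs B)))%:E
      <= W22eps mu eps P Q)%E.
  move=> mB; apply/ereal_infP => _ [q Pq <-]; rewrite QsE//.
  exact: (le_eot_objective heps mrP rP_ge0 PrP Pent pE).
have Wle : (W22eps mu eps P Qs <= c0%:E)%E.
  apply: le_trans (eot_objective_gibbs Hmu heps mrP rP_ge0 PrP Pent pE pQs).
  by apply: ereal_inf_lbound; exists p.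
have c0le (Q : probability (d.-tuple R) R) : (c0%:E <= W22eps mu eps P Q)%E.
  (* At [s = 0] the tilt disappears and only [c0] is left. *)
  have := leW Q 0 setT measurableT.
  by rewrite expR0 subrr !mul0r subrr mulr0 addr0.
exists Qs; split; last split.
- by move=> A mA; rewrite QsE//; exact: (gibbs_marginal2 Hmu heps mrP rP_ge0 PrP pE).
- by move=> Q; exact: le_trans Wle (c0le Q).
move=> Q QQs.
have QleQs B : measurable B -> fine (Q B) <= fine (Qs B).
  move=> mB; apply: le_of_expR_bound.
  - by rewrite -lee_fin fineK ?fin_num_measure//; exact: probability_le1.
  (* Equal optimal values leave no room above [c0], so the added multiple of [eps] is at most 0. *)
  - move=> s _; have := leW Q s B mB; rewrite QQs => /le_trans /(_ Wle).
    by rewrite lee_fin gerDl pmulr_rle0// subr_le0.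
  - exact: fine_ge0.
move=> A mA.
have fQ : Q A \is a fin_num by exact: fin_num_measure.
have fQs : Qs A \is a fin_num by exact: fin_num_measure.
rewrite -(fineK fQ) -(fineK fQs); congr (_%:E); apply/eqP.
rewrite eq_le QleQs//=.
(* Both total masses are 1, so the inequality on the complement reverses the one on [A]. *)
have := QleQs _ (measurableC mA).
rewrite !probability_setC// !fineB//; lra.
Qed.
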